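(* Let $Q\in\mathcal{M}$ be given and let $\mathcal{R}_Q:H_Q\to\mathcal{M}$ be the retraction map defined in the context. Let $U(t^m)=\mathcal{R}_Q(V(t^m))$, where $V(t^m)\in H_Q$ is the exact solution at a given time $t^m$ of the evolution problem $$\dot V(t)=\Big(\mathrm{d}\mathcal{R}_Q|_{V(t)}\Big)^{-1}\mathcal{F}\big(\mathcal{R}_Q(V(t))\big),\qquad V(t_0)=0,$$ and let $U_m=\mathcal{R}_Q(V_m)$, where $V_m\in H_Q$ is the numerical solution of this problem at time $t^m$ obtained with the explicit Runge--Kutta tangent scheme (Algorithm B in the context) with time step $\Delta t$. Assume that the numerical approximation of the evolution equation for the unknown $V$ on the tangent space is of order $O(\Delta t^k)$, that is $\|V(t^m)-V_m\|=O(\Delta t^k)$. Then $$\|U(t^m)-U_m\|=O(\Delta t^k).$$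
   Context: Let $n\le N$, $I_k$ the $k\times k$ identity, $J_{2m}:=\begin{pmatrix}0&I_m\\-I_m&0\end{pmatrix}\in\mathbb{R}^{2m\times 2m}$; $\|\cdot\|$ is the Frobenius norm. Let $\mathcal{M}:=\{U\in\mathbb{R}^{2N\times 2n}: U^\top U=I_{2n},\ U^\top J_{2N}U=J_{2n}\}$ and, for $U\in\mathcal{M}$, $H_U:=\{X\in\mathbb{R}^{2N\times 2n}: X^\top U=0,\ XJ_{2n}=J_{2N}X\}$. $\mathrm{Sym}(2n)$ denotes symmetric $2n\times 2n$ real matrices and $\mathfrak{sp}(2n):=\{M\in\mathbb{R}^{2n\times 2n}: MJ_{2n}+J_{2n}M^\top=0\}$. Fix $S\in\mathrm{Sym}(2n)\cap\mathfrak{sp}(2n)$ and set $\Theta^S_Q(V):=V+Q\big(S-\tfrac12Q^\top V\big)$. The retraction is $$\mathcal{R}_Q(V):=\mathrm{cay}\big(\Theta^S_Q(V)Q^\top-Q\,\Theta^S_Q(V)^\top\big)Q,\qquad \mathrm{cay}(\Omega):=(I-\tfrac{\Omega}{2})^{-1}(I+\tfrac{\Omega}{2}).$$ $\mathrm{d}\mathcal{R}_Q|_V$ denotes its tangent map at $V$. $\mathcal{F}$ is the velocity field on $\mathcal{M}$, with $\mathcal{F}(U)\in H_U$ for all $U\in\mathcal{M}$, of the evolution problem $\dot U=\mathcal{F}(U)$, $U(t_0)=Q$, whose solution is written locally as $U(t)=\mathcal{R}_Q(V(t))$. In the paper $\mathcal{F}(U)=(I_{2N}-UU^\top)(J_{2N}YZ-YZJ_{2n}^\top)(Z^\top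 Z+J_{2n}^\top Z^\top ZJ_{2n})^{-1}$, where $Z\in\mathbb{R}^{p\times 2n}$ is given with $\mathrm{rank}(Z^\top Z+J_{2n}^\top Z^\top ZJ_{2n})=2n$ and $Y$ has columns $Y_j=\nabla\mathcal{H}(UZ_j^\top,\eta_j)$ for given smooth Hamiltonians $\mathcal{H}(\cdot,\eta_j)$ on $\mathbb{R}^{2N}$, $Z_j$ being the $j$-th row of $Z$. Algorithm B (one step of length $\Delta t$, starting from $V=0$ at base point $Q$). Given Butcher coefficients $(b_i)_{i=1}^s$, $(a_{i,j})_{1\le j<i\le s}$ of an explicit $s$-stage Runge--Kutta method, let $f(V):=(\mathrm{d}\mathcal{R}_Q|_V)^{-1}\mathcal{F}(\mathcal{R}_Q(V))$. Set $A^1=\mathcal{F}(Q)$, and $A^i=f\big(\Delta t\sum_{j=1}^{i-1}a_{i,j}A^j\big)$ for $i=2,\dots,s$. The numerical solution on the tangent space is $\Delta t\sum_{i=1}^s b_iA^i$, and the corresponding approximation on $\mathcal{M}$ is its image under $\mathcal{R}_Q$. It is assumed that the inverse tangent maps involved are well defined (as for sufficiently small times). *)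

(* Defs.v *)
From mathcomp Require Import all_boot all_order all_algebra.
From mathcomp Require Import all_classical all_reals all_analysis.

Set Implicit Arguments.
Unset Strict Implicit.
Unset Printing Implicit Defensive.

Import Order.TTheory GRing.Theory Num.Theory.
Import numFieldNormedType.Exports.

Local Open Scope classical_set_scope.
Local Open Scope ring_scope.

(* R^(2m) is rendered as dimension m + m, so that
   the symplectic matrix is a block matrix.  The normed-module structure that
   the library puts on matrices uses the sup norm; it is only used for limits
   and differentials (which do not depend on the norm), whereas error
   estimates use the Frobenius norm below. *)

Definition frob (R : realType) (m n : nat) (A : 'M[R]_(m, n)) : R :=
  Num.sqrt (\sum_i \sum_j A i j ^+ 2).

Definition Jmx (R : realType) (m : nat) : 'M[R]_(m + m) :=
  block_mx 0 1%:M (- 1%:M) 0.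
Arguments Jmx {R} m.

Definition manifold (R : realType) (N n : nat) : set 'M[R]_(N + N, n + n) :=
  [set U | U^T *m U = 1%:M /\ U^T *m Jmx N *m U = Jmx n].
Arguments manifold {R} N n.

Definition horizontal (R : realType) (N n : nat) (U : 'M[R]_(N + N, n + n)) :
    set 'M[R]_(N + N, n + n) :=
  [set X | X^T *m U = 0 /\ X *m Jmx n = Jmx N *m X].

Definition Sym (R : realType) (m : nat) : set 'M[R]_m := [set S | S^T = S].
Arguments Sym {R} m.

Definition sp (R : realType) (n : nat) : set 'M[R]_(n + n) :=
  [set M | M *m Jmx n + Jmx n *m M^T = 0].
Arguments sp {R} n.

Definition cay (R : realType) (m : nat) (Om : 'M[R]_m) : 'M[R]_m :=
  invmx (1%:M - 2^-1 *: Om) *m (1%:M + 2^-1 *: Om).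

Section Retraction.
Variables (R : realType) (N n : nat).
Local Notation mat := 'M[R]_(N + N, n + n).
Implicit Types (Q V W X : mat) (S : 'M[R]_(n + n)).

Definition Theta S Q V : mat := V + Q *m (S - 2^-1 *: (Q^T *m V)).

(* The formula makes sense for every matrix V; the retraction is its
   restriction to [horizontal Q]. *)
Definition retr S Q V : mat :=
  cay (Theta S Q V *m Q^T - Q *m (Theta S Q V)^T) *m Q.

(* The retraction is defined on the vector space [horizontal Q], which is its
   own tangent space at every V; hence the tangent map at V is the restriction
   to [horizontal Q] of the differential of [retr S Q]. *)
Definition tangent_preimage S Q V W : set mat :=
  [set X | horizontal Q X /\ 'd (retr S Q) V X = W].

Definition inv_tangent_defined S Q V W : Prop :=
  exists! X, tangent_preimage S Q V W X.

(* Meaningful under [inv_tangent_defined]; 0 when there is no preimage. *)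
Definition inv_tangent S Q V W : mat := xget 0 (tangent_preimage S Q V W).

Variable F : mat -> mat.

Definition tangent_field S Q V : mat := inv_tangent S Q V (F (retr S Q V)).

Definition tangent_field_defined S Q V : Prop :=
  inv_tangent_defined S Q V (F (retr S Q V)).

(* V solves V' = (dR_Q|_V)^-1 F(R_Q(V)), V(t0) = 0, on the closed interval
   [t0, t1]; the derivative at t is taken within [t0, t1], so it is one-sided
   at the endpoints. *)
Definition exact_tangent_solution S Q (t0 t1 : R) (V : R -> mat) : Prop :=
  V t0 = 0 /\
  forall t : R, t0 <= t <= t1 ->
    [/\ horizontal Q (V t), tangent_field_defined S Q (V t) &
        (u - t)^-1 *: (V u - V t) @[u --> within `[t0, t1] t^']
          --> tangent_field S Q (V t)].

(* Stages of the explicit Runge-Kutta scheme, numbered from 0: [rk_stages k]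
   lists the first k of them.  Only the coefficients [a i j] with j < i are
   used. *)
Definition rk_arg (a : nat -> nat -> R) (dt : R) (i : nat) (As : seq mat) :
    mat := dt *: \sum_(j < i) a i j *: As`_j.

Fixpoint rk_stages S Q (a : nat -> nat -> R) (dt : R) (k : nat) : seq mat :=
  if k is i.+1 then
    let As := rk_stages S Q a dt i in
    rcons As (if i == 0%N then F Q else tangent_field S Q (rk_arg a dt i As))
  else [::].

Definition rk_solution S Q s (a : nat -> nat -> R) (b : nat -> R) (dt : R) :
    mat := dt *: \sum_(i < s) b i *: (rk_stages S Q a dt s)`_i.

Definition rk_defined S Q s (a : nat -> nat -> R) (dt : R) : Prop :=
  forall i : nat, (0 < i < s)%N ->
    tangent_field_defined S Q (rk_arg a dt i (rk_stages S Q a dt i)).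

End Retraction.

(* The velocity field of the reduced Hamiltonian system: one instance of a
   field F with F(U) horizontal at every point U of the manifold. *)
Section HamiltonianVelocity.
Variables (R : realType) (N n p : nat).
Variables (H : 'I_p -> 'cV[R]_(N + N) -> R) (Z : 'M[R]_(p, n + n)).

Definition grad (m : nat) (h : 'cV[R]_m -> R) (x : 'cV[R]_m) : 'cV[R]_m :=
  \col_i 'D_(delta_mx i 0) h x.

Definition gradients (U : 'M[R]_(N + N, n + n)) : 'M[R]_(N + N, p) :=
  \matrix_(i, j) grad (H j) (U *m (row j Z)^T) i 0.

Definition gram : 'M[R]_(n + n) :=
  Z^T *m Z + (Jmx n)^T *m Z^T *m Z *m Jmx n.

Definition hamiltonian_velocity (U : 'M[R]_(N + N, n + n)) :
    'M[R]_(N + N, n + n) :=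
  let YZ := gradients U *m Z in
  (1%:M - U *m U^T) *m (Jmx N *m YZ - YZ *m (Jmx n)^T) *m invmx gram.

Lemma tr_Jmx m : (Jmx m)^T = - Jmx m :> 'M[R]_(m + m).
Proof.
by rewrite /Jmx tr_block_mx opp_block_mx !trmx0 linearN /= trmx1 oppr0 opprK.
Qed.

Lemma mul_JJ m : Jmx m *m Jmx m = - 1%:M :> 'M[R]_(m + m).
Proof.
rewrite /Jmx mulmx_block !mul0mx !mulmx0 !mul1mx ?mulmx1 !add0r !addr0.
by rewrite -[X in - X]/(scalar_mx 1) scalar_mx_block opp_block_mx oppr0.
Qed.

Lemma mxtr_eq0 a b (A : 'M[R]_(a, b)) : A^T *m A = 0 -> A = 0.
Proof.
move=> A0; apply/matrixP => i j; rewrite mxE.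
have /matrixP/(_ j j) := A0; rewrite !mxE => /eqP.
rewrite psumr_eq0; last by move=> k _; rewrite mxE -expr2 sqr_ge0.
by move=> /allP/(_ i); rewrite mem_index_enum mxE => /(_ isT) /=; rewrite mulf_eq0 orbb => /eqP.
Qed.

Lemma manifold_comm (U : 'M[R]_(N + N, n + n)) :
  manifold N n U -> Jmx N *m U = U *m Jmx n.
Proof.
move=> [U1 U2]; apply/eqP; rewrite -subr_eq0; apply/eqP/mxtr_eq0.
rewrite [(_ - _)^T]linearB /= !trmx_mul !tr_Jmx mulmxBl !mulmxBr.
rewrite !mulmxN !mulNmx.
have -> : U^T *m Jmx N *m (Jmx N *m U) = - 1%:M.
  by rewrite -mulmxA (mulmxA (Jmx N)) mul_JJ mulNmx mul1mx mulmxN U1.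
have -> : U^T *m Jmx N *m (U *m Jmx n) = - 1%:M by rewrite mulmxA U2 mul_JJ.
have -> : Jmx n *m U^T *m (Jmx N *m U) = - 1%:M.
  by rewrite -mulmxA (mulmxA U^T) U2 mul_JJ.
have -> : Jmx n *m U^T *m (U *m Jmx n) = - 1%:M.
  by rewrite -mulmxA (mulmxA U^T) U1 mul1mx mul_JJ.
by rewrite subrr.
Qed.

Lemma hamiltonian_velocity_horizontal (U : 'M[R]_(N + N, n + n)) :
  \rank gram = (n + n)%N -> manifold N n U ->
  horizontal U (hamiltonian_velocity U).
Proof.
move=> rk MU; have JU := manifold_comm MU; case: MU => U1 U2.
have gU : gram \in unitmx by rewrite -row_free_unit /row_free rk.
split; rewrite /hamiltonian_velocity; set Y := gradients U *m Z.
  rewrite !trmx_mul [(1%:M - _)^T]linearB /= trmx1 trmx_mul trmxK -!mulmxA.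
  by rewrite mulmxBl mul1mx -mulmxA U1 mulmx1 subrr !mulmx0.
have gJ : gram *m Jmx n = Jmx n *m gram.
  rewrite /gram tr_Jmx !mulNmx mulmxBl mulmxBr !mulmxA mul_JJ -!mulmxA mul_JJ.
  by rewrite !mulmxN mulmx1 mulNmx mul1mx !opprK addrC.
have igJ : invmx gram *m Jmx n = Jmx n *m invmx gram.
  by rewrite -[Jmx n in LHS](mulmxK gU) -gJ !mulmxA mulVmx // mul1mx.
have BJ : (Jmx N *m Y - Y *m (Jmx n)^T) *m Jmx n
        = Jmx N *m (Jmx N *m Y - Y *m (Jmx n)^T).
  rewrite tr_Jmx !mulmxN !opprK mulmxDl mulmxDr !mulmxA mul_JJ -!mulmxA mul_JJ.
  by rewrite !mulmxN mulmx1 mulNmx mul1mx addrC.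
have UJ : U^T *m Jmx N = Jmx n *m U^T.
  apply: (can_inj (@trmxK _ _ _)).
  by rewrite !trmx_mul !tr_Jmx trmxK mulNmx mulmxN JU.
have PJ : (1%:M - U *m U^T) *m Jmx N = Jmx N *m (1%:M - U *m U^T).
  by rewrite mulmxBl mulmxBr mul1mx mulmx1 -mulmxA UJ !mulmxA JU.
by rewrite -[LHS]mulmxA igJ [LHS]mulmxA -(mulmxA _ _ (Jmx n)) BJ !mulmxA PJ.
Qed.

End HamiltonianVelocity.

(* Main.v *)
Require Import Defs.
From mathcomp Require Import all_boot all_order all_algebra.
From mathcomp Require Import all_classical all_reals all_analysis.
From mathcomp Require Import lra.

Set Implicit Arguments.
Unset Strict Implicit.
Unset Printing Implicit Defensive.

Import Order.TTheory GRing.Theory Num.Theory.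
Import numFieldNormedType.Exports.
Local Open Scope classical_set_scope.
Local Open Scope ring_scope.

(** The retraction is globally Lipschitz, with constant 2, for the Frobenius
    norm; hence it maps two tangent vectors at distance O(dt^k) to two points at
    distance O(dt^k).

    The retraction is the composition of three maps.
    - V |-> Theta Q^T - Q Theta^T is affine with skew-symmetric values.  Its
      linear part W |-> D Q^T - Q D^T, with D = (I - Q Q^T / 2) W, expands
      distances by a factor at most 2, because the columns of Q are orthonormal
      ([frob_skew_part], [frob_half_proj]).
    - The Cayley transform does not expand distances between skew-symmetric
      matrices ([frob_cay_sub]).  Indeed Y and Om Y are orthogonal when Om is
      skew-symmetric, so I - Om / 2 is invertible with an inverse of operator
      norm at most 1, and
        cay A - cay B = (I - A / 2)^-1 (A - B) (I - B / 2)^-1.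
    - Right multiplication by Q does not increase the Frobenius norm
      ([frob_mul_orthR]).

    Each estimate follows from ||A||^2 = \tr (A^T A) and its nonnegativity for
    a suitable A, after expanding the trace. *)

(** * The Frobenius norm *)

Lemma frob_ge0 (R : realType) m n (A : 'M[R]_(m, n)) : 0 <= frob A.
Proof. exact: sqrtr_ge0. Qed.

Lemma sqr_frob (R : realType) m n (A : 'M[R]_(m, n)) :
  frob A ^+ 2 = \tr (A^T *m A).
Proof.
rewrite sqr_sqrtr; last first.
  by apply: sumr_ge0 => i _; apply: sumr_ge0 => j _; rewrite sqr_ge0.
rewrite exchange_big; apply: eq_bigr => j _; rewrite mxE.
by apply: eq_bigr => i _; rewrite mxE expr2.
Qed.

Lemma trace_sqr_ge0 (R : realType) m n (A : 'M[R]_(m, n)) :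
  0 <= \tr (A^T *m A).
Proof. by rewrite -sqr_frob sqr_ge0. Qed.

Lemma ler_frob (R : realType) m n p q
    (A : 'M[R]_(m, n)) (B : 'M[R]_(p, q)) :
  (frob A <= frob B) = (\tr (A^T *m A) <= \tr (B^T *m B)).
Proof. by rewrite -!sqr_frob ler_pXn2r // nnegrE frob_ge0. Qed.

Lemma frob_tr (R : realType) m n (A : 'M[R]_(m, n)) : frob A^T = frob A.
Proof.
by apply/le_anti; rewrite !ler_frob trmxK (mxtrace_mulC A) lexx.
Qed.

Lemma frob_eq0 (R : realType) m n (A : 'M[R]_(m, n)) : frob A <= 0 -> A = 0.
Proof.
move=> A0; apply/matrixP => i j; rewrite mxE.
have : frob A ^+ 2 = 0.
  by rewrite (_ : frob A = 0) ?expr0n //; apply/le_anti; rewrite A0 frob_ge0.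
rewrite sqr_frob => /eqP; rewrite psumr_eq0 => [|l _]; last first.
  by rewrite mxE sumr_ge0 // => h _; rewrite mxE -expr2 sqr_ge0.
move=> /allP/(_ j); rewrite mem_index_enum => /(_ isT) /=.
rewrite mxE psumr_eq0 => [|h _]; last by rewrite mxE -expr2 sqr_ge0.
move=> /allP/(_ i); rewrite mem_index_enum => /(_ isT) /=.
by rewrite mxE mulf_eq0 orbb => /eqP.
Qed.

(** * The Cayley transform of skew-symmetric matrices *)

(** The trace of [Y^T *m Om *m Y] equals that of its transpose, its opposite. *)
Lemma trace_skew (R : realType) m n (Om : 'M[R]_m) (Y : 'M[R]_(m, n)) :
  Om^T = - Om -> \tr (Y^T *m Om *m Y) = 0.
Proof.
move=> skO; have : \tr (Y^T *m Om *m Y) = - \tr (Y^T *m Om *m Y); last by lra.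
by rewrite -{1}mxtrace_tr !trmx_mul trmxK skO mulNmx mulmxN mulmxA linearN.
Qed.

(** Pythagoras: the right-hand side squares to ||Y||^2 + ||Om Y||^2. *)
Lemma frob_sub_skewL (R : realType) m n (Om : 'M[R]_m) (Y : 'M[R]_(m, n)) :
  Om^T = - Om -> frob Y <= frob ((1%:M - Om) *m Y).
Proof.
move=> skO; rewrite ler_frob mulmxBl mul1mx [(_ - _)^T]linearB /=.
rewrite mulmxBl !mulmxBr !linearB /= mulmxA trace_skew //.
have -> : (Om *m Y)^T *m Y = - (Y^T *m Om *m Y).
  by rewrite trmx_mul skO mulmxN mulNmx.
rewrite linearN /= trace_skew //.
have := trace_sqr_ge0 (Om *m Y); lra.
Qed.

Lemma frob_sub_skewR (R : realType) m n (Om : 'M[R]_m) (Y : 'M[R]_(n, m)) :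
  Om^T = - Om -> frob Y <= frob (Y *m (1%:M - Om)).
Proof.
move=> skO; rewrite -(frob_tr Y) -(frob_tr (_ *m _)) trmx_mul [(_ - _)^T]linearB /=.
by rewrite trmx1; apply: frob_sub_skewL; rewrite trmxK skO opprK.
Qed.

Lemma sub_skew_unit (R : realType) m (Om : 'M[R]_m) :
  Om^T = - Om -> 1%:M - Om \in unitmx.
Proof.
move=> skO; rewrite -row_free_unit; apply: inj_row_free => v v0.
apply: frob_eq0; apply: le_trans (frob_sub_skewR v skO) _.
rewrite v0 /frob big1 ?sqrtr0 // => i _.
by rewrite big1 // => j _; rewrite mxE expr0n.
Qed.

(** This form contains Om only in the inverse, so that a difference of two
    Cayley transforms is twice a difference of two inverses. *)
Lemma cayE (R : realType) m (Om : 'M[R]_m) :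
  1%:M - 2^-1 *: Om \in unitmx ->
  cay Om = 2 *: invmx (1%:M - 2^-1 *: Om) - 1%:M.
Proof.
move=> uM; rewrite /cay.
have -> : 1%:M + 2^-1 *: Om = 2 *: 1%:M - (1%:M - 2^-1 *: Om).
  by rewrite scaler_nat mulr2n opprB addrA addrAC addrK.
by rewrite mulmxBr -scalemxAr mulmx1 mulVmx.
Qed.

Lemma frob_cay_sub (R : realType) m (A B : 'M[R]_m) :
  A^T = - A -> B^T = - B -> frob (cay A - cay B) <= frob (A - B).
Proof.
move=> skA skB.
have skA2 : (2^-1 *: A)^T = - (2^-1 *: A) by rewrite linearZ /= skA scalerN.
have skB2 : (2^-1 *: B)^T = - (2^-1 *: B) by rewrite linearZ /= skB scalerN.
have uA := sub_skew_unit skA2; have uB := sub_skew_unit skB2.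
(* the resolvent identity X^-1 - Y^-1 = X^-1 (Y - X) Y^-1 *)
have -> : cay A - cay B = invmx (1%:M - 2^-1 *: A) *m (A - B) *m
                          invmx (1%:M - 2^-1 *: B).
  rewrite !cayE // opprB addrA subrK -scalerBr.
  have -> : A - B = 2 *: ((1%:M - 2^-1 *: B) - (1%:M - 2^-1 *: A)).
    rewrite opprB [X in 2 *: X]addrC addrA subrK -scalerBr scalerA.
    by rewrite divff ?scale1r.
  rewrite -scalemxAr -scalemxAl mulmxBr mulmxBl mulVmx // mul1mx.
  by rewrite mulmxK.
apply: le_trans (frob_sub_skewR _ skB2) _; rewrite mulmxKV //.
by apply: le_trans (frob_sub_skewL _ skA2) _; rewrite mulmxA mulmxV // mul1mx.
Qed.

(** * Multiplication by a matrix with orthonormal columns *)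

Section OrthonormalColumns.
Variables (R : realType) (p q : nat) (Q : 'M[R]_(p, q)).
Hypothesis orthQ : Q^T *m Q = 1%:M.

(** Since Q Q^T is an orthogonal projection, the square of the right-hand side
    exceeds that of the left-hand side by 3/4 ||Q^T W||^2. *)
Lemma frob_half_proj n (W : 'M[R]_(p, n)) :
  frob (W - 2^-1 *: (Q *m (Q^T *m W))) <= frob W.
Proof.
rewrite ler_frob [(_ - _)^T]linearB /= [(_ *: _)^T]linearZ /=.
rewrite !trmx_mul trmxK mulmxBl !mulmxBr -!scalemxAl -!scalemxAr.
have -> : W^T *m Q *m Q^T *m W = (Q^T *m W)^T *m (Q^T *m W).
  by rewrite trmx_mul trmxK !mulmxA.
have -> : W^T *m (Q *m (Q^T *m W)) = (Q^T *m W)^T *m (Q^T *m W).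
  by rewrite trmx_mul trmxK !mulmxA.
have -> : W^T *m Q *m Q^T *m (Q *m (Q^T *m W)) = (Q^T *m W)^T *m (Q^T *m W).
  by rewrite -mulmxA (mulmxA Q^T) orthQ mul1mx trmx_mul trmxK.
rewrite !(raddfB, raddfN) /= !mxtraceZ.
by have := trace_sqr_ge0 (Q^T *m W); lra.
Qed.

(** Pythagoras again: the squares differ by ||X (I - Q Q^T)||^2. *)
Lemma frob_mul_orthR n (X : 'M[R]_(n, p)) : frob (X *m Q) <= frob X.
Proof.
rewrite -(frob_tr (X *m Q)) -(frob_tr X) ler_frob !trmxK.
have := trace_sqr_ge0 (X - X *m Q *m Q^T)^T; rewrite trmxK.
rewrite [(_ - _)^T]linearB /= !trmx_mul !trmxK mulmxBl !mulmxBr !mulmxA.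
have -> : X *m Q *m Q^T *m Q = X *m Q by rewrite -mulmxA orthQ mulmx1.
by rewrite !linearB /=; lra.
Qed.

(** Both summands have the norm of [D], and the square of a difference is at
    most twice the sum of the squares. *)
Lemma frob_skew_part (D : 'M[R]_(p, q)) :
  frob (D *m Q^T - Q *m D^T) <= 2 * frob D.
Proof.
have n1 : \tr ((D *m Q^T)^T *m (D *m Q^T)) = \tr (D^T *m D).
  rewrite mxtrace_mulC trmx_mul trmxK -mulmxA (mulmxA Q^T) orthQ mul1mx.
  exact: mxtrace_mulC.
have n2 : \tr ((Q *m D^T)^T *m (Q *m D^T)) = \tr (D^T *m D).
  rewrite trmx_mul trmxK -mulmxA (mulmxA Q^T) orthQ mul1mx.
  exact: mxtrace_mulC.
rewrite -(@ler_pXn2r _ 2) ?nnegrE ?mulr_ge0 ?frob_ge0 // exprMn !sqr_frob.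
have := trace_sqr_ge0 (D *m Q^T + Q *m D^T).
rewrite [(_ - _)^T]linearB [(_ + _)^T]linearD /=.
rewrite !(mulmxBl, mulmxBr, mulmxDl, mulmxDr) !(raddfB, raddfD) /= n1 n2.
lra.
Qed.

End OrthonormalColumns.

(** * The retraction *)

Lemma Theta_sub (R : realType) N n S (Q V W : 'M[R]_(N + N, n + n)) :
  Theta S Q V - Theta S Q W =
  (V - W) - 2^-1 *: (Q *m (Q^T *m (V - W))).
Proof.
rewrite /Theta opprD addrACA; congr (_ + _).
rewrite -mulmxBr opprB addrC addrA subrK -scalerBr -mulmxBr.
by rewrite -scalemxAr -opprB linearN /= linearN /= scalerN.
Qed.

Lemma retr_lipschitz (R : realType) N n S (Q V W : 'M[R]_(N + N, n + n)) :
  Q^T *m Q = 1%:M -> frob (retr S Q V - retr S Q W) <= 2 * frob (V - W).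
Proof.
move=> orthQ.
have skew X : (Theta S Q X *m Q^T - Q *m (Theta S Q X)^T)^T =
              - (Theta S Q X *m Q^T - Q *m (Theta S Q X)^T).
  by rewrite [LHS]linearB /= !trmx_mul !trmxK opprB.
rewrite /retr -mulmxBl; apply: le_trans (frob_mul_orthR orthQ _) _.
apply: le_trans (frob_cay_sub (skew V) (skew W)) _.
have -> : Theta S Q V *m Q^T - Q *m (Theta S Q V)^T -
          (Theta S Q W *m Q^T - Q *m (Theta S Q W)^T) =
          (Theta S Q V - Theta S Q W) *m Q^T -
          Q *m (Theta S Q V - Theta S Q W)^T.
  by rewrite [(Theta S Q V - _)^T]linearB /= mulmxBl mulmxBr opprD addrACA -opprD.
apply: le_trans (frob_skew_part orthQ _) _.
by rewrite ler_wpM2l // Theta_sub frob_half_proj.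
Qed.

Theorem corollary5p8 (R : realType) (N n : nat) (hnN : (n <= N)%N)
  (S : 'M[R]_(n + n)) (hSym : Sym (n + n) S) (hsp : sp n S)
  (F : 'M[R]_(N + N, n + n) -> 'M[R]_(N + N, n + n))
  (hF : forall U, manifold N n U -> horizontal U (F U))
  (Q : 'M[R]_(N + N, n + n)) (hQ : manifold N n Q)
  (* the exact solution on the tangent space *)
  (t0 t1 : R) (ht : t0 < t1) (V : R -> 'M[R]_(N + N, n + n))
  (hV : exact_tangent_solution F S Q t0 t1 V)
  (* the explicit Runge-Kutta method; one step leads from t0 to t0 + dt *)
  (s : nat) (hs : (0 < s)%N) (a : nat -> nat -> R) (b : nat -> R)
  (hrk : \forall dt \near (0 : R)^'+, rk_defined F S Q s a dt)
  (k : nat)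
  (horder :
    (fun dt : R => frob (V (t0 + dt) - rk_solution F S Q s a b dt))
      =O_ ((0 : R)^'+) (fun dt : R => dt ^+ k)) :
  (fun dt : R =>
     frob (retr S Q (V (t0 + dt)) - retr S Q (rk_solution F S Q s a b dt)))
    =O_ ((0 : R)^'+) (fun dt : R => dt ^+ k).
Proof.
case: hQ => orthQ _; apply: eqO_trans horder; apply/eqOP.
near=> c; near=> dt; rewrite !ger0_norm ?frob_ge0 //.
apply: le_trans (retr_lipschitz S _ _ orthQ) _.
by rewrite ler_wpM2r ?frob_ge0.
Unshelve. all: by end_near.
Qed.
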